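(* For Lebesgue-almost every real $r\in(0,1)$, there is a set $A\subseteq\omega$ with $A\le_T r$ such that $A$ has intrinsic density $r$ but $A$ computes no $r$-random set.
   Context: A real $r\in(0,1)$ is identified, for computability purposes, with the set $\{n : \text{the } n\text{-th bit of the binary expansion of } r \text{ is } 1\}$. For $A\subseteq\omega$, $\rho_n(A)=|A\cap\{0,\dots,n-1\}|/n$, $\overline{\rho}(A)=\limsup_n\rho_n(A)$, $\underline{\rho}(A)=\liminf_n\rho_n(A)$, and $\rho(A)$ is their common value if they agree. $A$ has intrinsic density $\alpha$ (written $P(A)=\alpha$) if $\rho(\pi(A))=\alpha$ for every computable permutation $\pi$ of $\omega$. For $0<r<1$, the Bernoulli measure $\mu_r$ on Cantor space is given by $\mu_r(\sigma)=r^{|\{n<|\sigma|:\sigma(n)=1\}|}(1-r)^{|\{n<|\sigma|:\sigma(n)=0\}|}$ on cylinders; a set is $r$-random if it is Martin-Löf random with respect to $\mu_r$, i.e. (in the sense of Reimann and Slaman) Martin-Löf random relative to some representation of the measure $\mu_r$. *)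

(* Defs.v *)
From HB Require Import structures.
From mathcomp Require Import all_boot all_order all_algebra.
From mathcomp Require Import all_classical all_reals all_analysis.

Set Implicit Arguments.
Unset Strict Implicit.
Unset Printing Implicit Defensive.

Import Order.TTheory GRing.Theory Num.Theory.
Import numFieldNormedType.Exports.

Local Open Scope classical_set_scope.
Local Open Scope ring_scope.

(** * Oracle computability *)

(* Cantor's pairing function, a bijection from nat * nat to nat *)
Definition cpair (x y : nat) : nat := (((x + y) * (x + y).+1)./2 + y)%N.

(* Programs for the partial recursive functions in an oracle.  Programs are
   unary: several arguments are passed as one number by means of cpair. *)
Inductive prog : Type :=
| Zero | Succ | Fst | Snd | Query
| Pair of prog & prog
| Comp of prog & prog
| Prec of prog & prog
| Mu of prog.

(* [eval f c x y]: the program c with oracle f halts on input x with output y.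
   - In the case of Prec, h lists the successive values of the recursion
       h 0 = p(a),  h (i + 1) = q(a, i, h i),  i < n.
   - In the case of Mu, y is the least zero of p(x, _), and p(x, m) is required
     to be defined for all m < y. *)
Fixpoint eval (f : nat -> nat) (c : prog) (x y : nat) {struct c} : Prop :=
  match c with
  | Zero => y = 0%N
  | Succ => y = x.+1
  | Fst => exists b, x = cpair y b
  | Snd => exists a, x = cpair a y
  | Query => y = f x
  | Pair p q => exists a b, [/\ eval f p x a, eval f q x b & y = cpair a b]
  | Comp p q => exists2 z, eval f q x z & eval f p z y
  | Prec p q => exists a n (h : nat -> nat),
      [/\ x = cpair a n, eval f p a (h 0%N),
          forall i, (i < n)%N -> eval f q (cpair a (cpair i (h i))) (h i.+1)
        & y = h n]
  | Mu p => eval f p (cpair x y) 0%N /\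
      forall m, (m < y)%N -> exists k, eval f p (cpair x m) k.+1
  end.

Definition computable_in (f g : nat -> nat) : Prop :=
  exists c, forall n, eval f c n (g n).

Definition computable (g : nat -> nat) : Prop := computable_in (fun=> 0%N) g.

(* domains of partial functions computable in f *)
Definition ce_in (f : nat -> nat) (W : set nat) : Prop :=
  exists c, forall n, W n <-> exists y, eval f c n y.

Definition charf (A : set nat) (n : nat) : nat := n \in A.

Definition turing_le (A B : set nat) : Prop :=
  computable_in (charf B) (charf A).

(** * Asymptotic and intrinsic density *)

Definition rho (R : realType) (A : set nat) (n : nat) : R :=
  #|[pred i : 'I_n | (i : nat) \in A]|%:R / n%:R.

Definition upper_density (R : realType) (A : set nat) : R := limn_sup (rho R A).

Definition lower_density (R : realType) (A : set nat) : R := limn_inf (rho R A).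

Definition has_density (R : realType) (A : set nat) (a : R) : Prop :=
  upper_density R A = a /\ lower_density R A = a.

Definition has_intrinsic_density (R : realType) (A : set nat) (a : R) : Prop :=
  forall p : nat -> nat, bijective p -> computable p -> has_density (p @` A) a.

(** * Reals as sets of natural numbers *)

(* Bit 0 is the first one after the binary point; for a dyadic rational this is
   the expansion ending in zeros. *)
Definition bits (R : realType) (r : R) : set nat :=
  [set n | odd (Num.truncn (2 ^+ n.+1 * r))].

(** * Martin-Loef randomness for a measure given by its values on cylinders *)

(* bijective base 2 numeration: a bijection from binary strings to nat *)
Fixpoint strcode (s : seq bool) : nat :=
  if s is b :: s' then ((strcode s').*2.+1 + b)%N else 0%N.

Definition bernoulli_cyl (R : realType) (r : R) (s : seq bool) : R :=
  r ^+ count_mem true s * (1 - r) ^+ count_mem false s.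

(* f is a representation of mu if it is a fast Cauchy name, uniformly in s, of
   the reals mu s: | f(s, k) / 2 ^ k - mu s | <= 2 ^ - k. *)
Definition represents (R : realType) (f : nat -> nat) (mu : seq bool -> R) :
    Prop :=
  forall (s : seq bool) (k : nat),
    `| (f (cpair (strcode s) k))%:R / 2 ^+ k - mu s | <= 2 ^- k.

(* V n is the set of strings generating the n-th open set of the test. *)
Definition ml_test (R : realType) (f : nat -> nat) (mu : seq bool -> R)
    (V : nat -> set (seq bool)) : Prop :=
  ce_in f [set m | exists n s, V n s /\ m = cpair n (strcode s)] /\
  forall n, (\esum_(s in V n) (mu s)%:E <= (2 ^- n)%:E)%E.

Definition prefix_of (s : seq bool) (X : set nat) : Prop :=
  s = mkseq (fun i => i \in X) (size s).

Definition captured (V : nat -> set (seq bool)) (X : set nat) : Prop :=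
  forall n, exists2 s, V n s & prefix_of s X.

Definition ml_random_rel (R : realType) (f : nat -> nat) (mu : seq bool -> R)
    (X : set nat) : Prop :=
  forall V, ml_test f mu V -> ~ captured V X.

Definition ml_random (R : realType) (mu : seq bool -> R) (X : set nat) : Prop :=
  exists2 f, represents f mu & ml_random_rel f mu X.

Definition r_random (R : realType) (r : R) (X : set nat) : Prop :=
  ml_random (bernoulli_cyl r) X.

(* Main.v *)
From mathcomp Require Import all_boot all_order all_algebra.
From mathcomp Require Import all_classical all_reals all_analysis.
From mathcomp Require Import zify ring lra.
Require Import Defs.

(* Every representation of [mu_r] computes [r] when [r] is not dyadic, so a set
   [X] that is Turing below [r] is computable in every representation, and its
   initial segments form a test capturing it: no such [X] is [r]-random.  It
   therefore suffices to find [A] of intrinsic density [r] below [r].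

   Put [n] in [A] iff the bits of [r] in positions [n ^ 2 .. n ^ 2 + n), read as
   an integer, are less than the integer [T n] given by the first [n] bits.  For
   [r] uniform, the conditional probability of this given the first [n ^ 2] bits
   is [T n / 2 ^ n], which converges to [r].  Hence the deviations
   [1_A(n) - T n / 2 ^ n] are bounded and pairwise orthogonal, and the law of
   large numbers holds along any injective enumeration of the indices: apply
   Chebyshev and Borel-Cantelli to the partial sums of length [k ^ 4].  There are
   only countably many computable permutations. *)

Set Implicit Arguments.
Unset Strict Implicit.
Unset Printing Implicit Defensive.

Import Order.TTheory GRing.Theory Num.Theory.
Import numFieldNormedType.Exports.

Local Open Scope classical_set_scope.
Local Open Scope ring_scope.

(** * Computability relative to an oracle *)

Section Pairing.
Local Open Scope nat_scope.

Let tri n := (n * n.+1)./2.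

Let triS n : tri n.+1 = tri n + n.+1.
Proof. by rewrite /tri; lia. Qed.

Let tri_homo : {homo tri : m n / m <= n}.
Proof. by apply: homo_leq => // [? ? ?|n]; [exact: leq_trans|rewrite triS leq_addr]. Qed.

Let cpairE x y : cpair x y = tri (x + y) + y.
Proof. by []. Qed.

(** The diagonal x + y = d occupies the codes from [tri d] to [tri d + d], all below [tri d.+1], so
    a larger sum forces a larger code. *)
Let cpair_sum x y x' y' : cpair x y = cpair x' y' -> x + y <= x' + y'.
Proof.
rewrite !cpairE => e; rewrite leqNgt; apply/negP => /tri_homo.
by rewrite triS; lia.
Qed.

Lemma cpair_inj x y x' y' : cpair x y = cpair x' y' -> x = x' /\ y = y'.
Proof.
move=> e; have := cpair_sum e; have := cpair_sum (esym e) => le1 le2.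
have es : x + y = x' + y' by lia.
by move: e; rewrite !cpairE es; lia.
Qed.

(** Increasing a code by one moves one step along its diagonal, or to the start of the next diagonal
    when the first coordinate is 0. *)
Lemma cpair_surj x : exists a b, x = cpair a b.
Proof.
elim: x => [|x [[|a] [b ->]]]; first by exists 0, 0.
  by exists b.+1, 0; rewrite !cpairE !addn0 !add0n triS addnS.
by exists a, b.+1; rewrite !cpairE !addnS addSn.
Qed.

Definition cfst x : nat := sval (cid (cpair_surj x)).
Definition csnd x : nat := sval (cid (svalP (cid (cpair_surj x)))).

Lemma cpairK x : cpair (cfst x) (csnd x) = x.
Proof. exact: esym (svalP (cid (svalP (cid (cpair_surj x))))). Qed.

Lemma cfst_cpair x y : cfst (cpair x y) = x.
Proof. by have [] := cpair_inj (cpairK (cpair x y)). Qed.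

Lemma csnd_cpair x y : csnd (cpair x y) = y.
Proof. by have [] := cpair_inj (cpairK (cpair x y)). Qed.

End Pairing.

Lemma eval_fun f c x y y' : eval f c x y -> eval f c x y' -> y = y'.
Proof.
elim: c x y y' => [||||| p IHp q IHq| p IHp q IHq| p IHp q IHq| p IHp] x y y' /=.
- by move=> -> ->.
- by move=> -> ->.
- by move=> [b ->] [b'] /cpair_inj[].
- by move=> [b ->] [b'] /cpair_inj[].
- by move=> -> ->.
- move=> [a [b [pa qb ->]]] [a' [b' [pa' qb' ->]]].
  by rewrite (IHp _ _ _ pa pa') (IHq _ _ _ qb qb').
- by move=> [z qz pz] [z' qz']; rewrite (IHq _ _ _ qz' qz) => /(IHp _ _ _ pz).
- move=> [a [n [h [-> h0 hS ->]]]] [a' [n' [h' [/cpair_inj[<- <-] h'0 h'S ->]]]].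
  (* The two histories of the recursion agree at each index up to n, by induction on the index. *)
  have: (n <= n)%N by [].
  elim: {-2}n => [_|i IHi lt_in]; first exact: IHp h0 h'0.
  have := hS _ lt_in; rewrite IHi ?(ltnW lt_in)// => e.
  exact: IHq e (h'S _ lt_in).
- move=> [py lty] [py' lty'].
  (* If two minima differed, p would take both 0 and a successor at the smaller one. *)
  case: (ltngtP y y') => [/lty'[k pk]|/lty[k pk]|//].
  + by have := IHp _ _ _ py pk.
  + by have := IHp _ _ _ py' pk.
Qed.

Fixpoint oracle_subst (d c : prog) : prog :=
  match c with
  | Query => d
  | Pair p q => Pair (oracle_subst d p) (oracle_subst d q)
  | Comp p q => Comp (oracle_subst d p) (oracle_subst d q)
  | Prec p q => Prec (oracle_subst d p) (oracle_subst d q)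
  | Mu p => Mu (oracle_subst d p)
  | _ => c
  end.

Lemma eval_oracle_subst f g d c x y : (forall n, eval f d n (g n)) ->
  eval g c x y -> eval f (oracle_subst d c) x y.
Proof.
move=> fd; elim: c x y => [||||| p IHp q IHq| p IHp q IHq| p IHp q IHq| p IHp] x y //=.
- by move=> ->.
- by move=> [a [b [pa qb ->]]]; exists a, b; split; [exact: IHp|exact: IHq|].
- by move=> [z qz pz]; exists z; [exact: IHq|exact: IHp].
- move=> [a [n [h [-> h0 hS ->]]]]; exists a, n, h; split=> //; first exact: IHp.
  by move=> i lt_in; apply: IHq; exact: hS.
- move=> [py lty]; split; first exact: IHp.
  by move=> m /lty[k pk]; exists k; exact: IHp.
Qed.

Lemma computable_in_trans f g h :
  computable_in f g -> computable_in g h -> computable_in f h.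
Proof.
by move=> [d fd] [c gc]; exists (oracle_subst d c) => n; exact: eval_oracle_subst (gc n).
Qed.

(** * Closure properties of the functions computable in an oracle *)

Section Computable.
Variable f : nat -> nat.
Local Notation computable_in := (computable_in f).
Local Open Scope nat_scope.

Lemma computable_in_ext g h : g =1 h -> computable_in g -> computable_in h.
Proof. by move=> gh [c gc]; exists c => n; rewrite -gh. Qed.

Lemma computable_in_comp g h :
  computable_in g -> computable_in h -> computable_in (fun x => g (h x)).
Proof. by move=> [c gc] [d hd]; exists (Comp c d) => n /=; exists (h n). Qed.

Lemma computable_in_pair g h : computable_in g -> computable_in h ->
  computable_in (fun x => cpair (g x) (h x)).
Proof. by move=> [c gc] [d hd]; exists (Pair c d) => n /=; exists (g n), (h n). Qed.

Lemma computable_in_fst g : computable_in g -> computable_in (fun x => cfst (g x)).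
Proof.
by apply: computable_in_comp; exists Fst => n /=; exists (csnd n); rewrite cpairK.
Qed.

Lemma computable_in_snd g : computable_in g -> computable_in (fun x => csnd (g x)).
Proof.
by apply: computable_in_comp; exists Snd => n /=; exists (cfst n); rewrite cpairK.
Qed.

Lemma computable_in_id : computable_in id.
Proof.
exists (Pair Fst Snd) => n /=; exists (cfst n), (csnd n).
by split; [exists (csnd n)|exists (cfst n)|]; rewrite cpairK.
Qed.

Lemma computable_in_oracle g : computable_in g -> computable_in (fun x => f (g x)).
Proof. by apply: computable_in_comp; exists Query. Qed.

Lemma computable_in_succ g : computable_in g -> computable_in (fun x => (g x).+1).
Proof. by apply: computable_in_comp; exists Succ. Qed.

Lemma computable_in_cst m : computable_in (fun=> m).
Proof. by elim: m => [|m IHm]; [exists Zero|exact: computable_in_succ]. Qed.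

Lemma computable_in_rec g n s : computable_in g -> computable_in n ->
  computable_in (fun z => s (cfst z) (cfst (csnd z)) (csnd (csnd z))) ->
  computable_in (fun x => nat_rect (fun=> nat) (g x) (s x) (n x)).
Proof.
move=> [c gc] cn [d sd].
suff : computable_in (fun z => nat_rect (fun=> nat) (g (cfst z)) (s (cfst z)) (csnd z)).
  move=> /computable_in_comp/(_ (computable_in_pair computable_in_id cn)).
  by apply: computable_in_ext => x; rewrite /= cfst_cpair csnd_cpair.
exists (Prec c d) => z /=; exists (cfst z), (csnd z).
exists (nat_rect (fun=> nat) (g (cfst z)) (s (cfst z))); split=> //.
  by rewrite cpairK.
move=> i _; set h := nat_rect _ _ _.
by have := sd (cpair (cfst z) (cpair i (h i))); rewrite !(cfst_cpair, csnd_cpair).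
Qed.

Lemma computable_in_add g h : computable_in g -> computable_in h ->
  computable_in (fun x => g x + h x).
Proof.
move=> cg ch; have := @computable_in_rec g h (fun _ _ => succn) cg ch.
move=> /(_ (computable_in_succ (computable_in_snd (computable_in_snd computable_in_id)))).
by apply: computable_in_ext => x; elim: (h x) => [|n /= ->]; rewrite ?addn0 ?addnS.
Qed.

Lemma computable_in_mul g h : computable_in g -> computable_in h ->
  computable_in (fun x => g x * h x).
Proof.
move=> cg ch.
have := @computable_in_rec (fun=> 0) h (fun x _ y => y + g x) (computable_in_cst 0) ch.
case.
  apply: computable_in_add; first by do 2 apply: computable_in_snd; exact: computable_in_id.
  by apply: computable_in_comp => //; apply: computable_in_fst; exact: computable_in_id.
by move=> c ec; exists c => x; have := ec x; congr eval; elim: (h x) => [|n /= ->];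
  rewrite ?muln0 ?mulnSr.
Qed.

Lemma computable_in_sub g h : computable_in g -> computable_in h ->
  computable_in (fun x => g x - h x).
Proof.
have cpred k : computable_in k -> computable_in (fun x => (k x).-1).
  (* The recursion that returns its index and forgets the previous value is the predecessor. *)
  move=> ck; have := @computable_in_rec (fun=> 0) k (fun _ i _ => i) (computable_in_cst 0) ck.
  case; first by apply: computable_in_fst; apply: computable_in_snd; exact: computable_in_id.
  by move=> c ec; exists c => x; have := ec x; congr eval; case: (k x).
move=> cg ch; have := @computable_in_rec g h (fun _ _ => predn) cg ch.
case; first by apply: cpred; do 2 apply: computable_in_snd; exact: computable_in_id.
move=> c ec; exists c => x; have := ec x; congr eval.
by elim: (h x) => [|n /= ->]; rewrite ?subn0 ?subnS.
Qed.

Lemma computable_in_ltn g h : computable_in g -> computable_in h ->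
  computable_in (fun x => g x < h x).
Proof.
(* By truncated subtraction, g x < h x exactly when (g x).+1 - h x is 0. *)
move=> cg ch; apply: (@computable_in_ext (fun x => 1 - ((g x).+1 - h x))).
  by move=> x; lia.
by apply: computable_in_sub (computable_in_cst 1) (computable_in_sub (computable_in_succ cg) ch).
Qed.

Lemma computable_in_odd g : computable_in g -> computable_in (fun x => odd (g x)).
Proof.
move=> cg; have := @computable_in_rec (fun=> 0) g (fun _ _ y => 1 - y) (computable_in_cst 0) cg.
case.
  apply: computable_in_sub (computable_in_cst 1) _.
  by do 2 apply: computable_in_snd; exact: computable_in_id.
move=> c ec; exists c => x; have := ec x; congr eval.
by elim: (g x) => //= n ->; case: (odd n).
Qed.

Lemma computable_in_exp2 g : computable_in g -> computable_in (fun x => 2 ^ g x).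
Proof.
move=> cg; have := @computable_in_rec (fun=> 1) g (fun _ _ y => 2 * y) (computable_in_cst 1) cg.
case.
  apply: computable_in_mul (computable_in_cst 2) _.
  by do 2 apply: computable_in_snd; exact: computable_in_id.
move=> c ec; exists c => x; have := ec x; congr eval.
by elim: (g x) => //= n ->; rewrite expnS.
Qed.

Lemma computable_in_search g : computable_in g ->
    (forall x, exists y, g (cpair x y) = 0) ->
  exists2 h, computable_in h & forall x, g (cpair x (h x)) = 0.
Proof.
move=> [c gc] gex.
have gex' x : exists y, g (cpair x y) == 0 by have [y /eqP] := gex x; exists y.
exists (fun x => ex_minn (gex' x)); last by move=> x; case: ex_minnP => y /eqP.
exists (Mu c) => x /=; case: ex_minnP => y /eqP gy ymin.
split; first by have := gc (cpair x y); rewrite gy.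
move=> m lt_my; exists (g (cpair x m)).-1; rewrite prednK; first exact: gc.
by rewrite lt0n; apply/negP => /ymin; rewrite leqNgt lt_my.
Qed.

(** A search whose test ignores the search variable stops at once on a zero of [g] and never stops
    elsewhere. *)
Lemma ce_in_zeros g : computable_in g -> ce_in f [set x | g x = 0].
Proof.
move=> cg; have [c gc] : computable_in (fun z => g (cfst z)).
  by apply: computable_in_comp => //; apply: computable_in_fst; exact: computable_in_id.
exists (Mu c) => x /=; split=> [gx0|[y [ey _]]].
  by exists 0; split=> //; have := gc (cpair x 0); rewrite cfst_cpair gx0.
by have := eval_fun (gc (cpair x y)) ey; rewrite cfst_cpair.
Qed.

End Computable.

(** * Binary truncations and randomness *)

Section Truncation.
Variable R : realType.
Implicit Types r : R.

(** For r in [0, 1), this is the integer spelled by the first m bits of r, most significant bit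
    first. *)
Definition binary_trunc r m : nat := Num.truncn (2 ^+ m * r).

Lemma charf_bits r m : charf (bits r) m = odd (binary_trunc r m.+1).
Proof. by congr nat_of_bool; apply/idP/idP; rewrite inE. Qed.

Lemma binary_trunc_itv r m : 0 <= r ->
  (binary_trunc r m)%:R <= 2 ^+ m * r < (binary_trunc r m).+1%:R.
Proof. by move=> r0; apply: truncn_itv; rewrite mulr_ge0// exprn_ge0. Qed.

Lemma binary_trunc_div r m k : 0 <= r ->
  binary_trunc r m = (binary_trunc r (m + k) %/ 2 ^ k)%N.
Proof.
move=> r0; set T := binary_trunc r (m + k).
have /andP[T1 T2] := binary_trunc_itv (m + k) r0.
have p0 : 0 < 2 ^+ k :> R by rewrite exprn_gt0.
apply: truncn_def; rewrite exprD -mulrA mulrCA in T1 T2.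
apply/andP; split.
  rewrite -(ler_pM2l p0) (le_trans _ T1)// -natrX -natrM ler_nat mulnC.
  exact: leq_divM.
rewrite -(ltr_pM2l p0) (lt_le_trans T2)// -natrX -natrM ler_nat mulnC.
by apply: ltn_ceil; rewrite expn_gt0.
Qed.

Lemma binary_truncS r m : 0 <= r ->
  binary_trunc r m.+1 = (2 * binary_trunc r m + charf (bits r) m)%N.
Proof.
move=> r0; rewrite charf_bits (binary_trunc_div m 1 r0) addn1 expn1.
by rewrite {1}(divn_eq (binary_trunc r m.+1) 2) mulnC modn2.
Qed.

Lemma binary_trunc0 r : 0 <= r < 1 -> binary_trunc r 0 = 0%N.
Proof. by move=> r01; apply: truncn_def; rewrite expr0 mul1r. Qed.

Lemma computable_in_binary_trunc r : 0 <= r < 1 ->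
  computable_in (charf (bits r)) (binary_trunc r).
Proof.
move=> r01; have /andP[r0 _] := r01; set b := charf (bits r).
have := @computable_in_rec b (fun=> 0%N) id (fun _ i y => (2 * y + b i)%N)
  (computable_in_cst b 0) (computable_in_id b).
case.
  apply: computable_in_add.
    apply: computable_in_mul (computable_in_cst _ 2) _.
    by do 2 apply: computable_in_snd; exact: computable_in_id.
  apply: computable_in_oracle; apply: computable_in_fst; apply: computable_in_snd.
  exact: computable_in_id.
move=> c ec; exists c => x; have := ec x; congr eval.
by elim: x {ec} => [|n /= ->]; rewrite ?binary_trunc0// binary_truncS.
Qed.

(* A Cauchy name of [r] decides [t <= 2 ^ m * r < t + 1] once its precision
   beats the distance from [2 ^ m * r] to the integers. *)
Lemma represents_computes_bits f r : 0 < r < 1 ->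
    (forall m k : nat, 2 ^+ m * r <> k%:R) ->
    represents f (bernoulli_cyl r) ->
  computable_in f (charf (bits r)).
Proof.
move=> /andP[r0 r1] ndyadic frep.
(* 2 is [strcode [:: true]], and the measure of this cylinder is r itself. *)
pose a k := f (cpair 2 k).
have aP k : (a k)%:R - 1 <= 2 ^+ k * r <= (a k)%:R + 1.
  have := frep [:: true] k; rewrite /bernoulli_cyl /= expr0 expr1 mulr1 -/(a k).
  have p0 : 0 < 2 ^+ k :> R by rewrite exprn_gt0.
  rewrite ler_norml -(ler_pM2r p0) -[X in _ && X](ler_pM2r p0).
  rewrite mulrBl divfK ?gt_eqF// mulNr mulVf ?gt_eqF// [r * _]mulrC.
  by move=> /andP[h1 h2]; apply/andP; split; lra.
(* The product is a conjunction. Since [a (k + m)] is within 1 of 2 ^ (k + m) * r, success certifies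
   t <= 2 ^ m * r < t + 1. *)
pose test (m k t : nat) := ((t * 2 ^ k < a (k + m)) * ((a (k + m)).+1 < t.+1 * 2 ^ k))%N.
pose g z := (1 - test (cfst z) (cfst (csnd z)) (csnd (csnd z)))%N.
have test_trunc m k t : test m k t <> 0%N -> t = binary_trunc r m.
  rewrite /test; case: ltnP => // lo; case: ltnP => // hi _.
  apply/esym/truncn_def.
  have p0 : 0 < 2 ^+ k :> R by rewrite exprn_gt0.
  have /andP[] := aP (k + m)%N; rewrite exprD -mulrA => h1 h2.
  rewrite -(ler_pM2l p0) -[X in _ && X](ltr_pM2l p0); apply/andP; split.
    by apply: le_trans h1; rewrite -natrX -natrM lerBrDr natr1 ler_nat mulnC.
  by apply: le_lt_trans h2 _; rewrite -natrX -natrM natr1 ltr_nat mulnC.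
have cg : computable_in f g.
  have c1 : computable_in f (fun z => cfst z).
    by apply: computable_in_fst; exact: computable_in_id.
  have c2 : computable_in f (fun z => cfst (csnd z)).
    by apply: computable_in_fst; apply: computable_in_snd; exact: computable_in_id.
  have c3 : computable_in f (fun z => csnd (csnd z)).
    by do 2 apply: computable_in_snd; exact: computable_in_id.
  have ca : computable_in f (fun z => a (cfst (csnd z) + cfst z)%N).
    apply: computable_in_oracle; apply: computable_in_pair (computable_in_cst _ _) _.
    exact: computable_in_add.
  apply: computable_in_sub (computable_in_cst _ 1) _.
  apply: computable_in_mul; apply: computable_in_ltn => //.
  - by apply: computable_in_mul => //; exact: computable_in_exp2.
  - exact: computable_in_succ.
  - by apply: computable_in_mul (computable_in_exp2 c2); exact: computable_in_succ.
have gex m : exists y, g (cpair m y) = 0%N.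
  set t := binary_trunc r m; have /andP[lo hi] := binary_trunc_itv m (ltW r0).
  have lo' : t%:R < 2 ^+ m * r.
    by rewrite lt_neqAle lo andbT; apply/eqP => /esym; exact: ndyadic.
  (* The error 1 of [a] and the margin 1 of the test add up to 2, so any k with 2 ^ k * d > 2 makes
     the test succeed. *)
  set d := Num.min (2 ^+ m * r - t%:R) (t.+1%:R - 2 ^+ m * r).
  have d0 : 0 < d by rewrite lt_min !subr_gt0 lo' hi.
  have [k hk] : exists k : nat, 2 < 2 ^+ k * d.
    exists (Num.truncn (2 / d)).+1; rewrite -ltr_pdivrMr//.
    apply: lt_trans (truncnS_gt _) _; rewrite -natrX ltr_nat.
    exact: ltn_expl.
  have p0 : 0 < 2 ^+ k :> R by rewrite exprn_gt0.
  exists (cpair k t); rewrite /g !(cfst_cpair, csnd_cpair) /test.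
  have hk1 : 2 < 2 ^+ k * (2 ^+ m * r - t%:R).
    by apply: lt_le_trans hk _; rewrite ler_pM2l// ge_min lexx.
  have hk2 : 2 < 2 ^+ k * (t.+1%:R - 2 ^+ m * r).
    by apply: lt_le_trans hk _; rewrite ler_pM2l// ge_min lexx orbT.
  have /andP[] := aP (k + m)%N; rewrite exprD => h1 h2.
  have -> : (t * 2 ^ k < a (k + m))%N.
    by rewrite -(ltr_nat R) natrM natrX; lra.
  have -> // : ((a (k + m)).+1 < t.+1 * 2 ^ k)%N.
  by rewrite -(ltr_nat R) natrM natrX -[(a _).+1%:R]natr1; lra.
have [h ch hP] := computable_in_search cg gex.
have hT m : csnd (h m) = binary_trunc r m.
  apply: (test_trunc _ (cfst (h m))) => t0.
  by have := hP m; rewrite /g !(cfst_cpair, csnd_cpair) t0.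
apply: (@computable_in_ext _ (fun n => odd (csnd (h n.+1)))).
  by move=> n; rewrite charf_bits hT.
apply: computable_in_odd; apply: computable_in_snd.
by apply: computable_in_comp => //; apply: computable_in_succ; exact: computable_in_id.
Qed.

(** The first entry of a string is its lowest digit and the digits are 1 and 2, so an appended bit b
    becomes the top digit b + 1. This makes the codes of initial segments recursive in their
    length. *)
Lemma strcode_rcons s b : strcode (rcons s b) = (strcode s + 2 ^ size s * b.+1)%N.
Proof.
elim: s => [|a s IHs]; first by case: b.
by rewrite /= IHs expnS; lia.
Qed.

Lemma bernoulli_cyl_le r s : 0 <= r <= 1 ->
  bernoulli_cyl r s <= Num.max r (1 - r) ^+ size s.
Proof.
move=> /andP[r0 r1]; have r1' : 0 <= 1 - r by rewrite subr_ge0.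
rewrite /bernoulli_cyl -(count_predC (pred1 true) s) exprD.
rewrite (eq_count (_ : predC (pred1 true) =1 pred1 false)); last by case.
by apply: ler_pM; rewrite ?exprn_ge0// lerXn2r ?nnegrE ?le_max ?r0 ?lexx ?orbT.
Qed.

(* Since [mu_r] has no atoms, the initial segments of [X] of length [c * n]
   form a test. *)
Lemma computable_not_random f r X : 0 < r < 1 ->
  computable_in f (charf X) -> ~ ml_random_rel f (bernoulli_cyl r) X.
Proof.
move=> /andP[r0 r1] cX Xrand.
set M := Num.max r (1 - r).
have M0 : 0 <= M by rewrite le_max ltW.
have M1 : M < 1 by rewrite gt_max r1 ltrBlDr ltrDl.
(* Every c further bits at least halve the bound on the measure, so length c * n yields 2 ^ - n. *)
have [c Mc] : exists c, M ^+ c <= 2^-1.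
  have M1' : `|M| < 1 by rewrite ger0_norm.
  have /cvgrPdist_le/(_ 2^-1)[|c _ /(_ c (leqnn c))] := cvg_expr M1'.
    by rewrite invr_gt0.
  by move=> h; exists c; move: h; rewrite /= sub0r normrN ger0_norm ?exprn_ge0.
pose V n : set (seq bool) := [set mkseq (fun i => i \in X) (c * n)].
apply: (Xrand V); last first.
  by move=> n; exists (mkseq (fun i => i \in X) (c * n)) => //; rewrite /prefix_of size_mkseq.
split; last first.
  move=> n; rewrite /V esum_set1 ?lee_fin; last first.
    by rewrite mulr_ge0// exprn_ge0// ?subr_ge0 ltW.
  apply: le_trans (bernoulli_cyl_le _ _) _; first by rewrite !ltW.
  rewrite size_mkseq exprM -exprVn lerXn2r// nnegrE ?exprn_ge0//.
pose code k := strcode (mkseq (fun i => i \in X) k).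
have codeS k : code k.+1 = (code k + 2 ^ k * (charf X k).+1)%N.
  by rewrite /code /mkseq -addn1 iotaD map_cat cats1 strcode_rcons size_map size_iota.
have ccode : computable_in f code.
  have := @computable_in_rec f (fun=> 0%N) id (fun _ i y => (y + 2 ^ i * (charf X i).+1)%N)
    (computable_in_cst _ 0) (computable_in_id _).
  have ci : computable_in f (fun z => cfst (csnd z)).
    by apply: computable_in_fst; apply: computable_in_snd; exact: computable_in_id.
  case.
    apply: computable_in_add.
      by do 2 apply: computable_in_snd; exact: computable_in_id.
    apply: computable_in_mul; first exact: computable_in_exp2.
    by apply: computable_in_succ; exact: computable_in_comp.
  move=> d ed; exists d => x; have := ed x; congr eval.
  by elim: x {ed} => [//|n /= ->]; rewrite codeS.
(* The two truncated differences add up to a distance, which vanishes exactly on the codes of the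
   elements of the test. *)
have cdiff : computable_in f (fun m => ((csnd m - code (c * cfst m)) + (code (c * cfst m) - csnd m))%N).
  have cm1 : computable_in f (fun m => code (c * cfst m)%N).
    apply: computable_in_comp => //; apply: computable_in_mul (computable_in_cst _ _) _.
    by apply: computable_in_fst; exact: computable_in_id.
  have cm2 : computable_in f (fun m => csnd m).
    by apply: computable_in_snd; exact: computable_in_id.
  by apply: computable_in_add; exact: computable_in_sub.
have [d dP] := ce_in_zeros cdiff; exists d => m; rewrite -dP /=; split.
  by move=> [n [s [-> ->]]]; rewrite cfst_cpair csnd_cpair subnn.
move=> e; exists (cfst m), (mkseq (fun i => i \in X) (c * cfst m)); split=> //.
rewrite -/(code _) -[LHS]cpairK; congr cpair; lia.
Qed.

End Truncation.

(** * Orthogonality of the deviations *)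

Section Deviation.
Variable R : realType.
Implicit Types (T : nat -> nat) (n m L N : nat).

(* For [T = binary_trunc r], the bits of [r] in positions [n ^ 2 .. n ^ 2 + n)
   read as an integer in [0, 2 ^ n) are compared with the first [n] bits. *)
Definition block_lt T n : bool :=
  (T (n * n + n) < T n + 2 ^ n * T (n * n))%N.

Definition deviation T n : R := (block_lt T n)%:R - (T n)%:R / 2 ^+ n.

(** For m <= L, [dyadic L j m] is the common value of [binary_trunc r m] for r in [j / 2 ^ L, (j +
    1) / 2 ^ L). Averages over j < 2 ^ L thus serve as expectations. *)
Definition dyadic L (j m : nat) : nat := (j %/ 2 ^ (L - m))%N.

Lemma deviation_eq T T' n : (forall m, (m <= n * n + n)%N -> T m = T' m) ->
  deviation T n = deviation T' n.
Proof.
move=> TT'; rewrite /deviation /block_lt !TT' ?leq_addl ?leq_addr//.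
Qed.

Lemma dyadic_div L m n (j : nat) : (m <= n <= L)%N ->
  dyadic L j m = dyadic n (j %/ 2 ^ (L - n)) m.
Proof.
move=> mnL; rewrite /dyadic -divnMA -expnD; congr (_ %/ 2 ^ _)%N; lia.
Qed.

Lemma dyadic_lt L m j : (j < 2 ^ L)%N -> (m <= L)%N -> (dyadic L j m < 2 ^ m)%N.
Proof.
move=> jL mL; rewrite /dyadic ltn_divLR ?expn_gt0// -expnD.
by rewrite subnKC.
Qed.

Lemma deviation_norm_le1 T n : (T n < 2 ^ n)%N -> `|deviation T n| <= 1.
Proof.
move=> Tn; have p0 : 0 < 2 ^+ n :> R by rewrite exprn_gt0.
have h1 : 0 <= (T n)%:R / 2 ^+ n :> R by rewrite divr_ge0// ltW.
have h2 : (T n)%:R / 2 ^+ n <= 1 :> R.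
  by rewrite ler_pdivrMr// mul1r -natrX ler_nat ltnW.
rewrite /deviation ler_norml.
by case: block_lt => /=; apply/andP; split; lra.
Qed.

Lemma sum_divn n k (F : nat -> R) : (0 < k)%N ->
  \sum_(0 <= j < n * k) F (j %/ k)%N = k%:R * \sum_(0 <= i < n) F i.
Proof.
move=> k0; rewrite big_nat_mul mulr_sumr; apply: eq_bigr => i _.
under eq_big_nat => j /andP[ij ji].
  have -> : (j %/ k)%N = i.
    by apply/eqP; rewrite eqn_leq -ltnS ltn_divLR// ji leq_divRL.
  over.
by rewrite sumr_const_nat mulSn addnK mulr_natl.
Qed.

(* Given the first [b ^ 2] bits, the block of [b] is uniform on [0, 2 ^ b), so
   the deviation has conditional mean zero. *)
Lemma sum_deviation_eq0 (G : nat -> R) b L : (b * b + b <= L)%N ->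
  \sum_(0 <= j < 2 ^ L) G (dyadic L j (b * b)) * deviation (dyadic L j) b = 0.
Proof.
set B := (b * b + b)%N => BL.
have bB : (b * b <= B)%N by rewrite leq_addr.
pose F i := G (dyadic B i (b * b)) * deviation (dyadic B i) b.
(* The summand depends on the first B bits only, which reduces the sum from L bits to B bits. *)
rewrite (eq_bigr (fun j => F (j %/ 2 ^ (L - B))%N)); last first.
  move=> j _; rewrite /F -dyadic_div ?bB//; congr (_ * _).
  by apply: deviation_eq => m mB; rewrite (dyadic_div (n := B)) ?mB.
rewrite -{1}(subnKC BL) expnD sum_divn ?expn_gt0//.
rewrite [X in _ * X](_ : _ = 0) ?mulr0//.
rewrite expnD big_nat_mul big_nat_cond big1// => u /andP[/= ub _].
set q := dyadic (b * b) u b.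
(* The threshold q is read from the first b bits, which lie among the first b ^ 2 bits u, so it is
   constant while the block varies. *)
have bbb : (b <= b * b)%N by case: (b) => // n; rewrite leq_pmulr.
have qb : (q < 2 ^ b)%N by exact: dyadic_lt.
under eq_big_nat => j /andP[uj ju].
  have ju' : (j %/ 2 ^ (B - b * b))%N = u.
    rewrite addKn; apply/eqP; rewrite eqn_leq -ltnS ltn_divLR ?expn_gt0// ju.
    by rewrite leq_divRL ?expn_gt0.
  have -> : F j = G u * (((j < q + 2 ^ b * u)%N)%:R - q%:R / 2 ^+ b).
    rewrite /F /deviation /block_lt {1}/dyadic ju'; congr (_ * (_%:R - _)).
      congr (_ < _)%N; first by rewrite /dyadic subnn expn0 divn1.
      by rewrite (@dyadic_div B b (b * b)) ?bbb// ju' -/q /dyadic ju'.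
    by rewrite (@dyadic_div B b (b * b)) ?bbb// ju'.
  over.
rewrite -mulr_sumr sumrB sumr_const_nat mulSn addnK.
(* Exactly q of the 2 ^ b possible blocks are below q, which cancels 2 ^ b times q / 2 ^ b. *)
rewrite -[X in X - _]natr_sum [X in X%:R - _](_ : _ = q).
  by rewrite -[X in _ - X]mulr_natr natrX divfK ?subrr ?mulr0//.
rewrite -{1}[(u * 2 ^ b)%N]add0n big_addn addnK big_nat_cond.
under eq_bigr do rewrite mulnC ltn_add2r.
rewrite -big_nat_cond (big_cat_nat _ (ltnW qb))//=.
rewrite [X in (_ + X)%N]big_nat_cond [X in (_ + X)%N]big1; last first.
  by move=> i /andP[/andP[qi _] _]; rewrite ltnNge qi.
rewrite big_nat_cond (eq_bigr (fun=> 1%N)); last by move=> i /andP[/andP[_ ->]].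
by rewrite -big_nat_cond sum_nat_const_nat subn0 muln1 addn0.
Qed.

(** For a < b one has a ^ 2 + a <= b ^ 2, so the factor at a is a function of the first b ^ 2 bits,
    given which the factor at b has mean zero. *)
Lemma sum_deviation_mul_eq0 a b L : a <> b ->
    (a * a + a <= L)%N -> (b * b + b <= L)%N ->
  \sum_(0 <= j < 2 ^ L) deviation (dyadic L j) a * deviation (dyadic L j) b = 0.
Proof.
wlog ab : a b / (a < b)%N => [wlg neq aL bL|_ aL bL].
  case: (ltngtP a b) => [ab|ba|//]; first exact: wlg.
  by under eq_bigr do rewrite mulrC; apply: wlg => //; exact: nesym.
have abb : (a * a + a <= b * b)%N by nia.
have bbL : (b * b <= L)%N by apply: leq_trans bL; rewrite leq_addr.
rewrite -[RHS](sum_deviation_eq0 (fun u => deviation (dyadic (b * b) u) a) bL).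
apply: eq_bigr => j _; congr (_ * _); apply: deviation_eq => m ma.
by rewrite (@dyadic_div L m (b * b)) ?(leq_trans ma).
Qed.

Definition deviation_sum T (s : nat -> nat) N : R :=
  \sum_(0 <= i < N) deviation T (s i).

(** Orthogonality removes the cross terms, and each new square contributes at most 1 on average. *)
Lemma sum_deviation_sum_sqr (s : nat -> nat) L N : injective s ->
    (forall i, (i < N)%N -> (s i * s i + s i <= L)%N) ->
  \sum_(0 <= j < 2 ^ L) deviation_sum (dyadic L j) s N ^+ 2 <= N%:R * 2 ^+ L.
Proof.
move=> sinj; elim: N => [_|N IHN sL].
  by rewrite big1 ?mul0r// => j _; rewrite /deviation_sum big_geq// expr0n.
under eq_bigr do rewrite /deviation_sum big_nat_recr//= sqrrD -/(deviation_sum _ _ _).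
rewrite big_split big_split/=.
rewrite [X in _ + X + _](_ : _ = 0) ?addr0; last first.
  under eq_bigr do rewrite -mulr_natl mulr_suml mulr_sumr.
  rewrite exchange_big/= big_nat_cond big1// => i /andP[/andP[_ iN] _].
  rewrite -mulr_sumr sum_deviation_mul_eq0 ?mulr0 ?sL//; last exact: ltnW.
  by move=> /sinj e; rewrite e ltnn in iN.
rewrite -natr1 mulrDl mul1r lerD ?IHN//; first by move=> i iN; apply/sL/ltnW.
have -> : 2 ^+ L = \sum_(0 <= j < 2 ^ L) 1 :> R.
  by rewrite sumr_const_nat subn0 natrX.
rewrite big_nat_cond [leRHS]big_nat_cond; apply: ler_sum => j /andP[/andP[_ jL] _].
rewrite -real_normK ?num_real// expr_le1//; apply: deviation_norm_le1.
apply: dyadic_lt => //; apply: leq_trans (sL N _) => //; exact: leq_addl.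
Qed.

(** Interpolates between the lengths at which Borel-Cantelli controls the sums. *)
Lemma deviation_sum_tail T s M N : (forall n, (T n < 2 ^ n)%N) -> (M <= N)%N ->
  `|deviation_sum T s N| <= `|deviation_sum T s M| + (N - M)%:R.
Proof.
move=> TP MN; rewrite {1}/deviation_sum (big_cat_nat _ MN)//=.
apply: le_trans (ler_normD _ _) _; rewrite lerD2l.
apply: le_trans (ler_norm_sum _ _ _) _.
apply: le_trans (ler_sum _ (fun i _ => deviation_norm_le1 (TP (s i)))) _.
by rewrite sumr_const_nat.
Qed.

End Deviation.

(** * Intrinsic density *)

Section BlockSet.
Variable R : realType.
Local Notation mu := (@lebesgue_measure R).
Implicit Types (r : R) (s : nat -> nat).

Definition block_set r : set nat := [set n | block_lt (binary_trunc r) n].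

Lemma turing_le_block_set r : 0 <= r < 1 -> turing_le (block_set r) (bits r).
Proof.
move=> r01; have cT := computable_in_binary_trunc r01.
set b := charf (bits r) in cT; have cid := computable_in_id b.
apply: (@computable_in_ext _ (fun n => block_lt (binary_trunc r) n)).
  by move=> n; congr nat_of_bool; apply/idP/idP; rewrite inE.
have cnn := computable_in_mul cid cid.
apply: computable_in_ltn.
  exact: computable_in_comp cT (computable_in_add cnn cid).
apply: computable_in_add => //; apply: computable_in_mul; first exact: computable_in_exp2.
exact: computable_in_comp.
Qed.

Lemma binary_trunc_lt r n : 0 <= r < 1 -> (binary_trunc r n < 2 ^ n)%N.
Proof.
move=> /andP[r0 r1]; have p0 : 0 < 2 ^+ n :> R by rewrite exprn_gt0.
rewrite -(ltr_nat R); have /andP[h _] := binary_trunc_itv n r0.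
by apply: le_lt_trans h _; rewrite natrX -ltr_pdivlMl// mulVf ?gt_eqF.
Qed.

(* Chebyshev's inequality; the sum is constant on dyadic intervals of length
   [2 ^- L], so that the expectation is a finite average. *)
Lemma deviation_sum_tail_measure s N (c : R) : injective s -> 0 < c ->
  exists F : set R, [/\ measurable F,
    forall r, 0 <= r < 1 -> c <= `|deviation_sum R (binary_trunc r) s N| -> F r
    & (mu F <= (N%:R / c ^+ 2)%:E)%E].
Proof.
move=> sinj c0.
(* The first L bits determine all N deviations of the sum. *)
pose L := (\max_(i < N) (s i * s i + s i))%N.
have sL i : (i < N)%N -> (s i * s i + s i <= L)%N.
  by move=> iN; exact: (leq_bigmax (Ordinal iN)).
pose P j := c <= `|deviation_sum R (dyadic L j) s N|.
have p0 : 0 < 2 ^+ L :> R by rewrite exprn_gt0.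
pose I j : set R := if P j then `[j%:R / 2 ^+ L, j.+1%:R / 2 ^+ L[%classic else set0.
have mI j : measurable (I j) by rewrite /I; case: ifP.
have muI j : mu (I j) = ((P j)%:R / 2 ^+ L)%:E.
  rewrite /I; case: ifP => _; last by rewrite measure0 mul0r.
  rewrite lebesgue_measure_itv/= lte_fin ltr_pM2r ?invr_gt0// ltr_nat ltnSn.
  by rewrite -EFinD -mulrBl -natrB// subSnn.
exists (\big[setU/set0]_(j < 2 ^ L) I j); split.
- exact: bigsetU_measurable.
- move=> r r01; have /andP[r0 r1] := r01.
  pose j := binary_trunc r L.
  rewrite (_ : deviation_sum _ _ _ _ = deviation_sum R (dyadic L j) s N); last first.
    apply: eq_big_nat => i /andP[_ iN]; apply: deviation_eq => m ms.
    have mL := leq_trans ms (sL _ iN).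
    by rewrite (binary_trunc_div m (L - m) r0) subnKC.
  move=> Pj; rewrite -bigcup_mkord; exists j => /=; first exact: binary_trunc_lt.
  rewrite /I /P Pj /= in_itv/= ler_pdivrMr// ltr_pdivlMr// [r * _]mulrC.
  exact: binary_trunc_itv.
- have /le_trans : (mu (\big[setU/set0]_(j < 2 ^ L) I j) <= \sum_(j < 2 ^ L) mu (I j))%E.
    exact: (@le_mu_bigsetU _ _ _ mu I (2 ^ L)%N (fun i _ => mI i)).
  apply.
  under eq_bigr do rewrite muI.
  rewrite sumEFin lee_fin ler_pdivlMr ?exprn_gt0// -mulr_suml mulrAC ler_pdivrMr//.
  apply: le_trans (sum_deviation_sum_sqr R sinj sL).
  rewrite mulr_suml big_mkord; apply: ler_sum => j _.
  case: (boolP (P j)) => [Pj|_]; last by rewrite mul0r sqr_ge0.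
  by rewrite mul1r -[leRHS]real_normK ?num_real// lerXn2r ?nnegrE// ltW.
Qed.

(** For x >= 1 one has 1 / x ^ 2 <= 2 / x - 2 / (x + 1), because x + 1 <= 2 * x, and the right-hand
    sides telescope. *)
Lemma sum_inv_sqr_le n : \sum_(0 <= k < n) (k.+1%:R ^+ 2)^-1 <= 2 :> R.
Proof.
suff : \sum_(0 <= k < n) (k.+1%:R ^+ 2)^-1 <= 2 - 2 / n.+1%:R :> R.
  by move=> /le_trans; apply; rewrite gerBl divr_ge0.
elim: n => [|n IHn]; first by rewrite big_geq// divr1 subrr.
rewrite big_nat_recr//= -[n.+2%:R]natr1.
set x : R := n.+1%:R in IHn *; have x1 : 1 <= x by rewrite ler1n.
have x0 : 0 < x by exact: lt_le_trans x1.
suff h : (x ^+ 2)^-1 <= 2 / x - 2 / (x + 1).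
  by apply: le_trans (lerD IHn h) _; rewrite addrA subrK.
rewrite -subr_ge0 (_ : _ - _ = (x - 1) / (x ^+ 2 * (x + 1))).
  by rewrite divr_ge0 ?subr_ge0// mulr_ge0 ?sqr_ge0//; lra.
by field; rewrite !gt_eqF//; lra.
Qed.

(** With x = k + 1, length x ^ 4 and threshold x ^ 3, Chebyshev gives x ^ 4 / x ^ 6 = 1 / x ^ 2,
    which is summable, while the threshold is still negligible against the length. *)
Lemma ae_deviation_sum_lt s : injective s ->
  {ae mu, forall r, 0 <= r < 1 -> exists K : nat, forall k, (K <= k)%N ->
     `|deviation_sum R (binary_trunc r) s (k.+1 ^ 4)| < k.+1%:R ^+ 3}.
Proof.
move=> sinj.
have p0 k : 0 < k.+1%:R ^+ 3 :> R by rewrite exprn_gt0.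
pose F k := sval (cid (deviation_sum_tail_measure (k.+1 ^ 4) sinj (p0 k))).
have FP k := svalP (cid (deviation_sum_tail_measure (k.+1 ^ 4) sinj (p0 k))).
have mF k : measurable (F k) by have [] := FP k.
exists (lim_sup_set F); split.
- by apply: bigcapT_measurable => n; apply: bigcup_measurable => k _; exact: mF.
- apply: lim_sup_set_cvg0 => //.
  apply: (@le_lt_trans _ _ 2%:E); last exact: ltry.
  apply: lime_le; first by apply: is_cvg_nneseries => n _ _.
  apply: nearW => n.
  apply: (@le_trans _ _ (\sum_(0 <= k < n) ((k.+1%:R ^+ 2)^-1)%:E)%E).
    apply: lee_sum => k _; have [_ _ /le_trans] := FP k; apply.
    rewrite lee_fin natrX -!exprM ler_pdivrMr ?exprn_gt0//.
    by rewrite -[(3 * 2)%N]/(2 + 4)%N exprD mulKf// expf_neq0// pnatr_eq0.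
  by rewrite sumEFin lee_fin sum_inv_sqr_le.
- move=> r /= /not_implyP[r01 /forallNP nK] n _.
  have /existsNP[k /not_implyP[nk /negP]] := nK n; rewrite -leNgt => h.
  by exists k => //; have [_ + _] := FP k; exact.
Qed.

(** The exponents are distinct, so the sum is part of a geometric series. *)
Lemma sum_pow2_inj_le s N : injective s -> \sum_(0 <= i < N) 2 ^- s i <= 2 :> R.
Proof.
move=> sinj; pose M := (\max_(i < N) s i)%N.
have sM i : (i < N)%N -> (s i < M.+1)%N.
  by move=> iN; rewrite ltnS; exact: (leq_bigmax (Ordinal iN)).
pose s' (i : 'I_N) : 'I_M.+1 := Ordinal (sM _ (ltn_ord i)).
have s'inj : injective s' by move=> i j [] /sinj /val_inj.
rewrite big_mkord (eq_bigl (fun i => i \in [set: 'I_N]%SET)); last by move=> i; rewrite inE.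
rewrite -(big_imset (h := s') (fun k : 'I_M.+1 => 2 ^- k))/=; last first.
  by move=> i j _ _; exact: s'inj.
apply: (@le_trans _ _ (\sum_(k < M.+1) 2 ^- k)).
  by rewrite big_mkcond/=; apply: ler_sum => k _; case: ifP.
have -> : \sum_(k < M.+1) 2 ^- k = 2 - 2 * 2 ^- M.+1 :> R.
  elim: M.+1 => [|n IHn]; first by rewrite big_ord0 expr0 invr1 mulr1 subrr.
  rewrite big_ord_recr/= IHn exprS invfM; lra.
by rewrite gerBl mulr_ge0// invr_ge0 exprn_ge0.
Qed.

(** A number i lies in the image when its preimage [s i] lies in the set, so counting the image
    means summing along the inverse permutation. *)
Lemma card_image_block_set (p s : nat -> nat) r n : cancel p s -> cancel s p ->
  #|[pred i : 'I_n | (i : nat) \in p @` block_set r]|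
  = (\sum_(0 <= i < n) block_lt (binary_trunc r) (s i))%N.
Proof.
move=> ps sp; rewrite -sum1_card big_mkcond big_mkord; apply: eq_bigr => i _ /=.
rewrite inE; set b := block_lt _ _; rewrite (_ : (_ \in _) = b); first by case: b.
apply/idP/idP; rewrite inE /=; first by move=> [m + pm]; rewrite /b -pm ps.
by move=> bi; exists (s i).
Qed.

Lemma binary_trunc_dist r m : 0 <= r ->
  `|(binary_trunc r m)%:R / 2 ^+ m - r| <= 2 ^- m.
Proof.
move=> r0; have p0 : 0 < 2 ^+ m :> R by rewrite exprn_gt0.
have -> : (binary_trunc r m)%:R / 2 ^+ m - r
    = ((binary_trunc r m)%:R - 2 ^+ m * r) / 2 ^+ m by field; rewrite gt_eqF.
rewrite normrM normfV (gtr0_norm p0).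
apply: ler_piMl; first by rewrite invr_ge0 ltW.
have /andP[h1] := binary_trunc_itv m r0; rewrite -natr1 => h2.
by rewrite ler_norml; apply/andP; split; lra.
Qed.

(** Each term splits into a deviation and a truncation error of at most 2 ^ - s i; over distinct
    indices these errors total at most 2. *)
Lemma sum_block_lt_dist s r n : injective s -> 0 <= r ->
  `|(\sum_(0 <= i < n) block_lt (binary_trunc r) (s i))%N%:R - n%:R * r|
  <= `|deviation_sum R (binary_trunc r) s n| + 2.
Proof.
move=> sinj r0; set T := binary_trunc r.
have -> : (\sum_(0 <= i < n) block_lt T (s i))%N%:R - n%:R * r
    = deviation_sum R T s n + \sum_(0 <= i < n) ((T (s i))%:R / 2 ^+ s i - r).
  rewrite /deviation_sum -big_split/= natr_sum.
  under [RHS]eq_bigr do rewrite addrA subrK.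
  by rewrite sumrB sumr_const_nat subn0 mulr_natl.
apply: le_trans (ler_normD _ _) _; rewrite lerD2l.
apply: le_trans (ler_norm_sum _ _ _) _.
apply: le_trans (sum_pow2_inj_le n sinj).
by apply: ler_sum => i _; exact: binary_trunc_dist.
Qed.

Lemma fourth_power_bracket n : (0 < n)%N ->
  exists k, (k.+1 ^ 4 <= n < k.+2 ^ 4)%N.
Proof.
case: n => // n _; elim: n => [|n [k /andP[h1 h2]]]; first by exists 0%N.
have [lt|ge] := ltnP n.+2 (k.+2 ^ 4); first by exists k; rewrite lt (leq_trans h1).
by exists k.+1; rewrite ge/= (leq_ltn_trans h2)// ltn_exp2r.
Qed.

Lemma cvg_rho_block_set (p s : nat -> nat) r K : cancel p s -> cancel s p ->
    0 <= r < 1 ->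
    (forall k, (K <= k)%N ->
       `|deviation_sum R (binary_trunc r) s (k.+1 ^ 4)| < k.+1%:R ^+ 3) ->
  rho R (p @` block_set r) n @[n --> \oo] --> r.
Proof.
move=> ps sp r01 devK; have /andP[r0 r1] := r01.
apply/cvgrPdist_le => e e0.
(* 18 = 1 + 15 + 2: the deviation at the last fourth power, the gap up to n, and the truncation
   errors, each in units of x ^ 3 with x = k + 1. *)
pose K' := maxn K (Num.truncn (18 / e)).
exists (K'.+1 ^ 4)%N => // n /= Kn.
have n0 : (0 < n)%N by apply: leq_trans Kn; rewrite expn_gt0.
have [k /andP[kn nk]] := fourth_power_bracket n0.
have Kk : (K' <= k)%N.
  by rewrite -ltnS -ltnS -(ltn_exp2r _ _ (isT : (0 < 4)%N)) (leq_ltn_trans Kn).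
rewrite distrC /rho (card_image_block_set _ _ ps sp).
have n0' : 0 < n%:R :> R by rewrite ltr0n.
set c := (X in X%:R / _).
have -> : c%:R / n%:R - r = (c%:R - n%:R * r) / n%:R by field; rewrite gt_eqF.
rewrite normrM normfV (gtr0_norm n0') ler_pdivrMr//.
apply: le_trans (sum_block_lt_dist _ (can_inj sp) r0) _.
have := deviation_sum_tail R s (fun m => binary_trunc_lt m r01) kn.
have := devK _ (leq_trans (leq_maxl _ _) Kk).
set x : R := k.+1%:R => h1 h2.
have x1 : 1 <= x by rewrite ler1n.
(* For x >= 1, the gap 4 * x ^ 3 + 6 * x ^ 2 + 4 * x + 1 between fourth powers is at most (4 + 6 + 4
   + 1) * x ^ 3. *)
have h3 : (n - k.+1 ^ 4)%:R <= 15 * x ^+ 3.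
  have : (n - k.+1 ^ 4)%:R <= (k.+2 ^ 4 - k.+1 ^ 4)%:R :> R.
    by rewrite ler_nat leq_sub2r// ltnW.
  rewrite [X in _ <= X]natrB; last by rewrite leq_exp2r.
  rewrite !natrX -[k.+2%:R]natr1 -/x => /le_trans; apply.
  have -> : (x + 1) ^+ 4 - x ^+ 4
      = 15 * x ^+ 3 - (6 * x ^+ 2 * (x - 1) + 4 * x * (x ^+ 2 - 1) + (x ^+ 3 - 1)).
    by ring.
  have x0 : 0 <= x by exact: le_trans x1.
  rewrite gerBl; apply: addr_ge0; last by rewrite subr_ge0 exprn_ege1.
  apply: addr_ge0; apply: mulr_ge0; rewrite ?subr_ge0 ?exprn_ege1//.
    by rewrite mulr_ge0// exprn_ge0.
  by rewrite mulr_ge0.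
have h4 : 18 <= e * x.
  rewrite -ler_pdivrMl// mulrC ltW// (lt_le_trans (truncnS_gt _))// ler_nat.
  by rewrite ltnS (leq_trans (leq_maxr _ _) Kk).
have h5 : x ^+ 4 <= n%:R by rewrite -natrX ler_nat.
have h6 : 1 <= x ^+ 3 by rewrite exprn_ege1.
apply: (@le_trans _ _ (18 * x ^+ 3)); first by lra.
apply: (@le_trans _ _ (e * x ^+ 4)); last by rewrite ler_pM2l.
have -> : e * x ^+ 4 = e * x * x ^+ 3 by ring.
by apply: ler_wpM2r => //; lra.
Qed.

Lemma ae_density_block_set (p : nat -> nat) : bijective p ->
  {ae mu, forall r, 0 <= r < 1 -> has_density (p @` block_set r) r}.
Proof.
move=> [s ps sp]; apply: negligibleS (ae_deviation_sum_lt (can_inj sp)).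
apply: subsetC => r h r01.
have [K /(cvg_rho_block_set ps sp r01) cv] := h r01.
have lr : limn (rho R (p @` block_set r)) = r by exact/cvg_lim.
have icv : cvgn (rho R (p @` block_set r)) by apply/cvg_ex; exists r.
by split; rewrite /upper_density /lower_density ?cvg_limn_supE ?cvg_limn_infE.
Qed.

End BlockSet.

(** * Countable unions of null sets, and the conclusion *)

Fixpoint prog_code (c : prog) : nat :=
  match c with
  | Zero => cpair 0 0
  | Succ => cpair 1 0
  | Fst => cpair 2 0
  | Snd => cpair 3 0
  | Query => cpair 4 0
  | Pair p q => cpair 5 (cpair (prog_code p) (prog_code q))
  | Comp p q => cpair 6 (cpair (prog_code p) (prog_code q))
  | Prec p q => cpair 7 (cpair (prog_code p) (prog_code q))
  | Mu p => cpair 8 (prog_code p)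
  end.

Lemma prog_code_inj : injective prog_code.
Proof.
elim=> [||||| p IHp q IHq| p IHp q IHq| p IHp q IHq| p IHp] [||||| p' q'| p' q'| p' q'| p'];
  move=> /cpair_inj[]//= _; try by move=> /cpair_inj[/IHp-> /IHq->].
by move=> /IHp->.
Qed.

(** Exceptional sets are indexed by program codes. A code determines its program, and a program at
    most one total function, so each index concerns at most one permutation. *)
Lemma ae_intrinsic_density_block_set (R : realType) :
  {ae @lebesgue_measure R, forall r, 0 <= r < 1 ->
     has_intrinsic_density (block_set r) r}.
Proof.
pose N n : set R := [set r | exists c p, [/\ prog_code c = n, bijective p,
  forall m, eval (fun=> 0%N) c m (p m) &
  ~ (0 <= r < 1 -> has_density (p @` block_set r) r)]].
suff N0 n : (@lebesgue_measure R).-negligible (N n).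
  apply: negligibleS (negligible_bigcup N0) => r /= /not_implyP[r01].
  move=> /existsNP[p /not_implyP[pbij /not_implyP[[c pc] ndens]]].
  by exists (prog_code c) => //; exists c, p; split=> // /(_ r01).
have [[c [p [cn pbij pc]]]|none] := pselect (exists c p, [/\ prog_code c = n,
    bijective p & forall m, eval (fun=> 0%N) c m (p m)]); last first.
  rewrite (_ : N n = set0); first exact: negligible_set0.
  by apply/seteqP; split=> // r [c [p [? ? ? _]]]; apply: none; exists c, p.
apply: negligibleS (ae_density_block_set R pbij) => r [c' [p' [c'n _ p'c]]].
have cc' : c' = c by apply: prog_code_inj; rewrite cn.
have -> // : p' = p.
by apply/funext => m; apply: eval_fun (pc m); rewrite -cc'.
Qed.

(** Supplies the hypothesis under which [represents_computes_bits] recovers the bits; the excluded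
    reals are countably many. *)
Lemma ae_not_dyadic (R : realType) :
  {ae @lebesgue_measure R, forall r, forall m k : nat, 2 ^+ m * r <> k%:R}.
Proof.
pose D (mk : nat * nat) : R := mk.2%:R / 2 ^+ mk.1.
have cD : countable (range D) by apply: sub_countable (card_image_le _ _) _; exact: countableP.
have mD : measurable (range D) by apply: countable_measurable cD => t; exact: measurable_set1.
exists (range D); split=> //; first exact: countable_lebesgue_measure0.
move=> r /= /existsNP[m /existsNP[k /contrapT e]]; exists (m, k) => //.
by rewrite /D /= -e mulrAC divff ?mul1r// expf_neq0.
Qed.

Theorem theorem4p4 (R : realType) :
  {ae (@lebesgue_measure R), forall r : R, 0 < r < 1 ->
    exists A : set nat,
      [/\ turing_le A (bits r),
          has_intrinsic_density A r
        & ~ exists X : set nat, turing_le X A /\ r_random r X]}.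
Proof.
apply: negligibleS (negligibleU (ae_intrinsic_density_block_set R) (ae_not_dyadic R)).
rewrite -setCI; apply: subsetC => r [dens ndyadic] r01; have /andP[r0 r1] := r01.
have r01' : 0 <= r < 1 by rewrite ltW.
have Abits := turing_le_block_set r01'.
exists (block_set r); split=> //; first exact: dens.
move=> [X [XA [f frep Xrand]]]; apply: (computable_not_random r01 _ Xrand).
(* The reductions run from the representation f to the bits of r, then to the block set, then to
   X. *)
apply: computable_in_trans (computable_in_trans Abits XA).
exact: represents_computes_bits r01 ndyadic frep.
Qed.
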